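(* Let $Q$ be the closed equilateral triangle with vertices $(0,0)$, $(1,0)$, $(\tfrac12,\tfrac{\sqrt3}{2})$, and for $0<\alpha<1$ let $H(\alpha)$ be the image of $Q$ under the homothety of ratio $\alpha$ centred at the incenter of $Q$. Then $\inf\{\alpha: H(\alpha)\text{ intersects every nontrivial billiard path in }Q\}=\frac14.$
   Context: A billiard path in $Q$ starts at the vertex $(0,0)$ with initial direction $(\cos\phi,\sin\phi)$, $0\le\phi\le\pi/3$, and reflects specularly off the sides of $Q$. Formally, it is the image of the ray $\{t(\cos\phi,\sin\phi):t\ge0\}$ under the folding map from the plane onto $Q$ determined by the tiling of the plane by reflected copies of $Q$ (the tiling by unit equilateral triangles with vertex set $\{a(1,0)+b(\tfrac12,\tfrac{\sqrt3}{2}):a,b\in\mathbb{Z}\}$), each tile being mapped to $Q$ by the composition of reflections carrying it to $Q$. The path is nontrivial if $0<\phi<\pi/3$. *)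

(* Defs.v *)
From mathcomp Require Import all_boot all_order all_algebra.
From mathcomp Require Import all_classical all_reals all_analysis.
From mathcomp Require Import ring lra zify.

Set Implicit Arguments.
Unset Strict Implicit.
Unset Printing Implicit Defensive.

Import Order.TTheory GRing.Theory Num.Theory.
Local Open Scope classical_set_scope.
Local Open Scope ring_scope.

Section Plane.
Context {R : realType}.
Local Notation plane := (R * R)%type.

(* The library norm on R * R is the sup norm, hence the explicit Euclidean
   inner product and distance. *)
Definition dotp (u v : plane) : R := u.1 * v.1 + u.2 * v.2.
Definition edist (p q : plane) : R := Num.sqrt (dotp (p - q) (p - q)).

Definition triangle (A B C : plane) : set plane :=
  [set x | exists a b c : R, [/\ 0 <= a, 0 <= b, 0 <= c, a + b + c = 1
                               & x = a *: A + b *: B + c *: C]].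

(* Reflection across the line through p and q, meaningful for p != q:
   twice the orthogonal projection of x on that line, minus x. *)
Definition refl (p q x : plane) : plane :=
  2 *: (p + (dotp (x - p) (q - p) / dotp (q - p) (q - p)) *: (q - p)) - x.

(* Distance from x to the line through p and q, meaningful for p != q. *)
Definition line_dist (p q x : plane) : R :=
  `|(q - p).1 * (x - p).2 - (q - p).2 * (x - p).1| / edist p q.

Definition is_incenter (A B C x : plane) : Prop :=
  [/\ triangle A B C x, line_dist A B x = line_dist B C x
    & line_dist B C x = line_dist C A x].

(* The default value 0 is irrelevant for Q, which has exactly one incenter:
   see is_incenterE and incenterE below. *)
Definition incenter (A B C : plane) : plane :=
  xget 0 [set x | is_incenter A B C x].

Definition homothety (c : plane) (a : R) (x : plane) : plane :=
  c + a *: (x - c).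

Definition v0 : plane := (0, 0).
Definition v1 : plane := (1, 0).
Definition v2 : plane := (1 / 2, Num.sqrt 3 / 2).
Definition Q : set plane := triangle v0 v1 v2.

Definition H (a : R) : set plane := homothety (incenter v0 v1 v2) a @` Q.

Definition lattice : set plane :=
  [set x | exists a b : int, x = a%:~R *: v1 + b%:~R *: v2].

(* The sides of the tiles join the lattice points at distance 1. *)
Definition tile_edge (p q : plane) : Prop :=
  [/\ lattice p, lattice q & edist p q = 1].

Definition tile (T : set plane) : Prop :=
  exists p q r : plane,
    [/\ tile_edge p q, tile_edge q r, tile_edge r p & T = triangle p q r].

(* Compositions of reflections in lines spanned by sides of tiles. *)
Inductive refl_comp : (plane -> plane) -> Prop :=
| refl_comp_id : refl_comp id
| refl_comp_cons (f : plane -> plane) (p q : plane) :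
    refl_comp f -> tile_edge p q -> refl_comp (f \o refl p q).

(* Every point of a tile T is sent to Q by the composition of reflections
   carrying T onto Q; a point on a common side of several tiles may be folded
   through any of them. *)
Definition folds_to (x y : plane) : Prop :=
  exists (T : set plane) (f : plane -> plane),
    [/\ tile T, T x, refl_comp f, f @` T = Q & y = f x].

(* The default value 0 is never used: folds_to is total and functional, see
   folds_to_exists, folds_to_unique and foldP below. *)
Definition fold (x : plane) : plane :=
  xget 0 [set y | folds_to x y].

Definition ray (phi : R) : set plane :=
  [set x | exists2 t : R, 0 <= t & x = t *: (cos phi, sin phi)].

Definition billiard_path (phi : R) : set plane := fold @` ray phi.

End Plane.

Section Incenter.
Context {R : realType}.
Local Notation plane := (R * R)%type.
Local Notation s := (Num.sqrt (3 : R)).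

Lemma sqrt3_sq : s * s = 3. Proof. by rewrite -expr2 sqr_sqrtr. Qed.
Lemma sqrt3_gt0 : 0 < s. Proof. by rewrite sqrtr_gt0. Qed.

Lemma planeP (x y : plane) : x.1 = y.1 -> x.2 = y.2 -> x = y.
Proof. by case: x y => [? ?] [? ?] /= -> ->. Qed.

Lemma edistE (p q : plane) :
  edist p q = Num.sqrt ((p.1 - q.1) ^+ 2 + (p.2 - q.2) ^+ 2).
Proof. by rewrite /edist /dotp -!expr2. Qed.

Lemma edist_eq1 (p q : plane) :
  edist p q = 1 <-> (p.1 - q.1) ^+ 2 + (p.2 - q.2) ^+ 2 = 1.
Proof.
rewrite edistE; split=> [h|->]; last exact: sqrtr1.
by rewrite -[LHS]sqr_sqrtr ?addr_ge0 ?sqr_ge0// h expr1n.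
Qed.

Lemma is_incenterE (x : plane) :
  is_incenter v0 v1 v2 x <-> x = (1 / 2, s / 6).
Proof.
have s2 := sqrt3_sq; have s0 := sqrt3_gt0.
have e01 : edist (v0 : plane) v1 = 1 by apply/edist_eq1 => /=; ring.
have e12 : edist (v1 : plane) v2 = 1 by apply/edist_eq1 => /=; lra.
have e20 : edist (v2 : plane) v0 = 1 by apply/edist_eq1 => /=; lra.
rewrite /is_incenter /line_dist e01 e12 e20 !divr1 /=; split; last first.
  move=> -> /=; split.
  - exists (1/3), (1/3), (1/3); split; [lra|lra|lra|lra|].
    by apply: planeP; rewrite /= /GRing.scale /=; lra.
  - by congr (`| _ |); lra.
  - by congr (`| _ |); lra.
move=> [[a [b [c [a0 b0 c0 abc ->]]]]]; rewrite /= /GRing.scale /= => h1 h2.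
have E1 : `|c * s / 2| = `|a * s / 2|.
  rewrite -(_ : (1 - 0) * (a * 0 + b * 0 + c * (s / 2) - 0) -
    (0 - 0) * (a * 0 + b * 1 + c * (1 / 2) - 0) = c * s / 2); last by ring.
  rewrite h1; congr (`| _ |); rewrite (_ : a = 1 - b - c); [by field|lra].
have E2 : `|a * s / 2| = `|b * s / 2|.
  rewrite -E1.
  rewrite -(_ : (1 - 0) * (a * 0 + b * 0 + c * (s / 2) - 0) -
    (0 - 0) * (a * 0 + b * 1 + c * (1 / 2) - 0) = c * s / 2); last by ring.
  by rewrite h1 h2; congr (`| _ |); field.
have [ha hb hc] : [/\ 0 <= a * s / 2, 0 <= b * s / 2 & 0 <= c * s / 2].
  by split; nra.
rewrite !ger0_norm// in E1 E2.
have ca : c = a by apply: (mulIf (lt0r_neq0 s0)); lra.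
have ab : a = b by apply: (mulIf (lt0r_neq0 s0)); lra.
have -> : c = 1/3 by lra.
have -> : b = 1/3 by lra.
have -> : a = 1/3 by lra.
by apply: planeP; rewrite /= /GRing.scale /=; field.
Qed.

Lemma incenterE : incenter v0 v1 v2 = (1 / 2, s / 6) :> plane.
Proof.
apply/is_incenterE; apply: (@xgetPex _ _ [set x | is_incenter _ _ _ x]).
by exists (1 / 2, s / 6); apply/is_incenterE.
Qed.

End Incenter.

Section Fold.
Context {R : realType}.
Local Notation plane := (R * R)%type.
Local Notation s := (Num.sqrt (3 : R)).

(* Lattice coordinates; colored k is the class of the lattice points whose
   coordinate difference is k mod 3, preserved by all the reflections. *)
Definition pt (a b : int) : plane := a%:~R *: v1 + b%:~R *: v2.

Definition colored (k : int) (x : plane) : Prop :=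
  exists a b c : int, x = pt a b /\ a - b = k + 3 * c.

Lemma lattice_pt a b : lattice (pt a b). Proof. by exists a, b. Qed.

Lemma ptE a b : pt a b = (a%:~R + b%:~R / 2, b%:~R * s / 2).
Proof. by apply: planeP; rewrite /= /GRing.scale /=; ring. Qed.

Lemma pt_sqdist (a b c d : int) :
  ((pt a b).1 - (pt c d).1) ^+ 2 + ((pt a b).2 - (pt c d).2) ^+ 2
  = ((a - c) ^+ 2 + (a - c) * (b - d) + (b - d) ^+ 2)%:~R.
Proof.
have s2 := sqrt3_sq (R := R).
rewrite !ptE /= !(intrD, intrM, mulrNz, rmorphXn) /=.
set A := a%:~R; set B := b%:~R; set C := c%:~R; set D := d%:~R.
have -> : (B * s / 2 - D * s / 2) ^+ 2 = (B - D) ^+ 2 * (s * s) / 4 by field.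
by rewrite s2; field.
Qed.

Lemma tile_edge_pt (a b c d : int) :
  (a - c) ^+ 2 + (a - c) * (b - d) + (b - d) ^+ 2 = 1 ->
  tile_edge (pt a b) (pt c d).
Proof.
move=> h; split; [exact: lattice_pt|exact: lattice_pt|].
by apply/edist_eq1; rewrite pt_sqdist h.
Qed.

Lemma tile_edgeP (p q : plane) : tile_edge p q ->
  exists a b c d : int, [/\ p = pt a b, q = pt c d &
    (c - a) ^+ 2 + (c - a) * (d - b) + (d - b) ^+ 2 = 1].
Proof.
case=> [[a [b ->]] [c [d ->]]] /edist_eq1 h.
exists a, b, c, d; split => //.
move: h; rewrite -!/(pt _ _) pt_sqdist => /eqP.
rewrite -[1 in X in X -> _](mulr1z (1 : R)) eqr_int => /eqP <-; ring.
Qed.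

Lemma dot_unit (p q : plane) : edist p q = 1 -> dotp (q - p) (q - p) = 1.
Proof.
by move/edist_eq1 => h; rewrite /dotp /= -h; ring.
Qed.

Lemma refl_isom (p q x y : plane) : edist p q = 1 ->
  edist (refl p q x) (refl p q y) = edist x y.
Proof.
move=> /dot_unit h; rewrite !edistE /refl h divr1 divr1 /=.
congr Num.sqrt; move: h; rewrite /dotp /= /GRing.scale /=.
set u := q.1 - p.1; set v := q.2 - p.2 => h.
set m := x.1 - y.1; set n := x.2 - y.2.
transitivity (4 * (m * u + n * v) ^+ 2 * (u * u + v * v)
  - 4 * (m * u + n * v) ^+ 2 + m ^+ 2 + n ^+ 2); last by rewrite h; ring.
by rewrite /m /n; ring.
Qed.

Lemma refl_invol (p q x : plane) : edist p q = 1 -> refl p q (refl p q x) = x.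
Proof.
move=> /dot_unit h; rewrite /refl h !divr1.
move: h; rewrite /dotp; set u := (q - p) => h.
apply: planeP; rewrite /= /GRing.scale /= -/u.
all: set k := (x.1 - p.1) * u.1 + (x.2 - p.2) * u.2.
- transitivity (x.1 + (4 * k * (u.1 * u.1 + u.2 * u.2) - 4 * k) * u.1); last by rewrite h; ring.
  by rewrite /k /u /=; ring.
- transitivity (x.2 + (4 * k * (u.1 * u.1 + u.2 * u.2) - 4 * k) * u.2); last by rewrite h; ring.
  by rewrite /k /u /=; ring.
Qed.

Lemma refl_affine (p q A B C : plane) (a b c : R) : a + b + c = 1 ->
  refl p q (a *: A + b *: B + c *: C)
  = a *: refl p q A + b *: refl p q B + c *: refl p q C.
Proof.
move=> h; have -> : a = 1 - b - c by lra.
rewrite /refl /dotp; apply: planeP; rewrite /= /GRing.scale /=.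
all: set w := ((q.1 - p.1) * (q.1 - p.1) + (q.2 - p.2) * (q.2 - p.2))^-1; ring.
Qed.

Lemma refl_triangle (p q A B C : plane) : edist p q = 1 ->
  refl p q @` triangle A B C
  = triangle (refl p q A) (refl p q B) (refl p q C).
Proof.
move=> h; apply/seteqP; split=> x.
  by case=> _ [a [b [c [a0 b0 c0 abc ->]]]] <-; exists a, b, c; rewrite refl_affine.
case=> a [b [c [a0 b0 c0 abc ->]]].
exists (a *: A + b *: B + c *: C); last by rewrite refl_affine.
by exists a, b, c.
Qed.

Lemma refl_pt (a b c d m n : int) :
  (c - a) ^+ 2 + (c - a) * (d - b) + (d - b) ^+ 2 = 1 ->
  let N := 2 * (m - a) * (c - a) + 2 * (n - b) * (d - b)
    + (m - a) * (d - b) + (n - b) * (c - a) in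
  refl (pt a b) (pt c d) (pt m n)
  = pt (a + N * (c - a) - (m - a)) (b + N * (d - b) - (n - b)).
Proof.
move=> h N; have s2 := sqrt3_sq (R := R).
have e : edist (pt a b) (pt c d) = 1.
  by apply/edist_eq1; rewrite pt_sqdist -[RHS](mulr1z (1 : R)) -h; congr (_%:~R); ring.
have D : 2 * dotp (pt m n - pt a b) (pt c d - pt a b) = N%:~R.
  rewrite /dotp !ptE /= /N !(intrD, intrM, mulrNz) /=.
  set A := a%:~R; set B := b%:~R; set C := c%:~R; set D := d%:~R.
  set M := m%:~R; set N' := n%:~R.
  transitivity (2 * (M + N' / 2 - (A + B / 2)) * (C + D / 2 - (A + B / 2))
     + (N' - B) * (D - B) * (s * s) / 2); first by field.
  by rewrite s2; field.
rewrite /refl (dot_unit e) divr1 scalerDr scalerA D.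
rewrite !ptE; apply: planeP; rewrite /= /GRing.scale /= !(intrD, intrM, mulrNz) /=; by field.
Qed.

Lemma unit_steps (u v : int) : u ^+ 2 + u * v + v ^+ 2 = 1 ->
  (u = 1 \/ u = -1) /\ v = 0 \/ u = 0 /\ (v = 1 \/ v = -1) \/
  u = 1 /\ v = -1 \/ u = -1 /\ v = 1.
Proof.
move=> h.
have h4 : (2 * u + v) ^+ 2 + 3 * v ^+ 2 = 4.
  by transitivity (4 * (u ^+ 2 + u * v + v ^+ 2)); [ring|rewrite h].
have h5 : (2 * v + u) ^+ 2 + 3 * u ^+ 2 = 4.
  by transitivity (4 * (u ^+ 2 + u * v + v ^+ 2)); [ring|rewrite h].
have hv : -1 <= v <= 1 by nia.
have hu : -1 <= u <= 1 by nia.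
have : u = -1 \/ u = 0 \/ u = 1 by lia.
have : v = -1 \/ v = 0 \/ v = 1 by lia.
move=> {h4 h5 hu hv} ev eu; move: ev eu h.
by case=> [->|[->|->]] [->|[->|->]] h; (tauto || by move/eqP: h).
Qed.

Lemma refl_colored (p q x : plane) k : tile_edge p q -> colored k x ->
  colored k (refl p q x).
Proof.
move=> /tile_edgeP[a [b [c [d [-> -> h]]]]] [m [n [l [-> hk]]]].
rewrite refl_pt//; set N := (X in X * (c - a)).
exists (a + N * (c - a) - (m - a)), (b + N * (d - b) - (n - b)).
suff [z hz] : exists z : int, N * (c - a - (d - b)) - 2 * (m - a - (n - b)) = 3 * z.
  exists (l + z); split=> //; have -> : k + 3 * (l + z) = (k + 3 * l) + 3 * z by ring.
  by rewrite -hk -hz; ring.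
rewrite /N {N}; move: h; move: (c - a) (d - b) => u v /unit_steps.
case=> [[[->|->] ->]|[[-> [->|->]]|[[-> ->]|[-> ->]]]].
- by exists (n - b); ring.
- by exists (n - b); ring.
- by exists (a - m); ring.
- by exists (a - m); ring.
- by exists 0; ring.
- by exists 0; ring.
Qed.

Lemma refl_comp_colored (f : plane -> plane) k : refl_comp f ->
  forall x, colored k x -> exists2 y, colored k y & f y = x.
Proof.
elim=> [|g p q _ IH e] x kx; first by exists x.
have [y ky <-] := IH x kx; exists (refl p q y); first exact: refl_colored.
by case: e => _ _ e; rewrite /= refl_invol.
Qed.

Lemma refl_comp_colored_img (f : plane -> plane) k : refl_comp f ->
  forall x, colored k x -> colored k (f x).
Proof.
by elim=> [//|g p q _ IH e] x kx; apply: IH; exact: refl_colored.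
Qed.

Lemma refl_comp_isom (f : plane -> plane) : refl_comp f ->
  forall x y, edist (f x) (f y) = edist x y.
Proof. by elim=> [//|g p q _ IH [_ _ e]] x y /=; rewrite IH refl_isom. Qed.

Lemma vertex_pt : [/\ v0 = pt 0 0, v1 = pt 1 0 & v2 = pt 0 1].
Proof.
by split; rewrite ptE; apply: planeP => /=; field.
Qed.

Lemma sqdist_pt_ge1 (a b c d : int) : (a, b) != (c, d) ->
  1 <= ((pt a b).1 - (pt c d).1) ^+ 2 + ((pt a b).2 - (pt c d).2) ^+ 2.
Proof.
move=> ne; rewrite pt_sqdist -[1 in X in X <= _](mulr1z (1 : R)) ler_int.
have : a - c != 0 \/ b - d != 0.
  move: ne; rewrite xpair_eqE negb_and => /orP[?|?]; [left|right]; lia.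
move: (a - c) (b - d) => u v h.
have ge1 (w : int) : w != 0 -> 1 <= w ^+ 2.
  by move=> w0; rewrite -gtz0_ge1 lt0r sqrf_eq0 w0 sqr_ge0.
have [v0' | v0'] := eqVneq v 0.
  rewrite v0' in h *; rewrite mulr0 expr0n !addr0; apply: ge1.
  by case: h => //; rewrite eqxx.
have hv := ge1 v v0'; have hq : 0 <= (2 * u + v) ^+ 2 by exact: sqr_ge0.
have hE : (2 * u + v) ^+ 2 + 3 * v ^+ 2 = 4 * (u ^+ 2 + u * v + v ^+ 2) by ring.
by move: hE hq hv; move: (_ ^+ 2) (v ^+ 2) (u ^+ 2 + _) => A B C; lia.
Qed.

(* Among the lattice points of its own colour class, each vertex of Q is the
   nearest one to every point of Q. *)
Lemma nearest (i j a b c : int) (y : plane) :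
  (i, j) = (0, 0) \/ (i, j) = (1, 0) \/ (i, j) = (0, 1) ->
  Q y -> a - b = i - j + 3 * c -> edist y (pt i j) <= edist y (pt a b).
Proof.
move=> ij [t0 [t1 [t2 [h0 h1 h2 ht ->]]]] hc; rewrite !edistE.
rewrite ler_sqrt; last by rewrite addr_ge0// sqr_ge0.
have key (k l : int) : (k, l) = (0, 0) \/ (k, l) = (1, 0) \/ (k, l) = (0, 1) ->
    ((pt k l).1 - (pt i j).1) ^+ 2 + ((pt k l).2 - (pt i j).2) ^+ 2 <=
    ((pt k l).1 - (pt a b).1) ^+ 2 + ((pt k l).2 - (pt a b).2) ^+ 2.
  move=> kl; case: (eqVneq (k, l) (i, j)) => [[-> ->]|ne].
    by rewrite !subrr expr0n addr0 addr_ge0// sqr_ge0.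
  apply: (@le_trans _ _ 1); last first.
    apply: sqdist_pt_ge1; apply/eqP => -[ka lb]; move/eqP: ne; apply.
    by move: kl ij => [[? ?]|[[? ?]|[? ?]]] [[? ?]|[[? ?]|[? ?]]]; subst; (reflexivity || exfalso; lia).
  rewrite pt_sqdist -[1 in X in _ <= X](mulr1z (1 : R)) ler_int.
  by move: kl ij => [[-> ->]|[[-> ->]|[-> ->]]] [[-> ->]|[[-> ->]|[-> ->]]].
have k0 := key 0 0 (or_introl erefl).
have k1 := key 1 0 (or_intror (or_introl erefl)).
have k2 := key 0 1 (or_intror (or_intror erefl)).
case: vertex_pt k0 k1 k2 => <- <- <-.
have e1 : t1 = 1 - t0 - t2 by lra.
move: (pt i j) (pt a b) => [X Y] [Z W] /= k0 k1 k2.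
rewrite -subr_ge0 in k0; rewrite -subr_ge0 in k1; rewrite -subr_ge0 in k2.
have := addr_ge0 (addr_ge0 (mulr_ge0 h0 k0) (mulr_ge0 h1 k1)) (mulr_ge0 h2 k2).
move=> hh; rewrite -subr_ge0; apply: (le_trans hh); rewrite le_eqVlt.
by apply/orP; left; apply/eqP; rewrite /GRing.scale /= e1; field.
Qed.

Lemma Q_eq (x y : plane) : edist x v0 = edist y v0 ->
  edist x v1 = edist y v1 -> edist x v2 = edist y v2 -> x = y.
Proof.
have s2 := sqrt3_sq (R := R); have s0 := sqrt3_gt0 (R := R).
have sqE (u v : plane) : edist u v ^+ 2 = (u.1 - v.1) ^+ 2 + (u.2 - v.2) ^+ 2.
  by rewrite edistE sqr_sqrtr// addr_ge0// sqr_ge0.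
move=> /(congr1 (fun z => z ^+ 2)); rewrite !sqE /= => h0.
move=> /(congr1 (fun z => z ^+ 2)); rewrite !sqE /= => h1.
move=> /(congr1 (fun z => z ^+ 2)); rewrite !sqE /= => h2.
have e1 : x.1 = y.1 by lra.
apply: planeP => //; rewrite e1 in h0 h1 h2.
by apply: (mulIf (lt0r_neq0 s0)); lra.
Qed.

Lemma folds_to_unique (x y y' : plane) : folds_to x y -> folds_to x y' -> y = y'.
Proof.
have half (i j : int) u u' :
    (i, j) = (0, 0) \/ (i, j) = (1, 0) \/ (i, j) = (0, 1) ->
    folds_to x u -> folds_to x u' -> edist u' (pt i j) <= edist u (pt i j).
  move=> ij [T [f [_ Tx cf fT ->]]] [T' [f' [_ Tx' cf' fT' ->]]].
  have [p pk fp] : exists2 p, colored (i - j) p & f p = pt i j.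
    by apply: refl_comp_colored => //; exists i, j, 0; rewrite mulr0 addr0.
  rewrite -[in leRHS]fp (refl_comp_isom cf) -(refl_comp_isom cf' x p).
  have [a [b [c [-> hc]]]] := refl_comp_colored_img cf' pk.
  by apply: (nearest ij _ hc); rewrite -fT'; exists x.
move=> h h'; case: vertex_pt => e0 e1 e2.
by apply: Q_eq; rewrite ?e0 ?e1 ?e2; apply/le_anti/andP; split; apply: half => //; auto.
Qed.

Definition foldable (T : set plane) : Prop :=
  exists2 f, refl_comp f & f @` T = Q.

Lemma foldable_refl (A B C p q A' B' C' : plane) : tile_edge p q ->
  refl p q A = A' -> refl p q B = B' -> refl p q C = C' ->
  foldable (triangle A B C) -> foldable (triangle A' B' C').
Proof.
move=> e <- <- <- [f cf fT]; exists (f \o refl p q); first exact: refl_comp_cons.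
case: e => _ _ e; rewrite -fT -refl_triangle// image_comp.
by apply: eq_imagel => z _ /=; rewrite refl_invol.
Qed.

Lemma triangle_rot (A B C : plane) : triangle A B C = triangle B C A.
Proof.
apply/seteqP; split=> x [a [b [c [a0 b0 c0 abc ->]]]].
- by exists b, c, a; split=> //; [rewrite addrC addrA|rewrite -addrA addrC].
- by exists c, a, b; split=> //; [rewrite -addrA addrC|rewrite addrC addrA].
Qed.

Definition up_tile (m n : int) : set plane :=
  triangle (pt m n) (pt (m + 1) n) (pt m (n + 1)).
Definition down_tile (m n : int) : set plane :=
  triangle (pt (m + 1) (n + 1)) (pt (m + 1) n) (pt m (n + 1)).

Ltac flip a b c d := apply: (@foldable_refl _ _ _ (pt a b) (pt c d));
  [by apply: tile_edge_pt; ring|rewrite refl_pt; [congr pt; ring|ring]..].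

Lemma foldable_down m n : foldable (up_tile m n) -> foldable (down_tile m n).
Proof. by flip (m + 1) n m (n + 1). Qed.

Lemma foldable_up m n : foldable (down_tile m n) -> foldable (up_tile m n).
Proof. by flip (m + 1) n m (n + 1). Qed.

Lemma foldable_right m n : foldable (up_tile m n) <-> foldable (up_tile (m + 1) n).
Proof.
split=> [/foldable_down|h].
  rewrite /up_tile -triangle_rot.
  by flip (m + 1) n (m + 1) (n + 1).
apply: foldable_up; rewrite /down_tile triangle_rot; move: h.
by flip (m + 1) n (m + 1) (n + 1).
Qed.

Lemma foldable_above m n : foldable (up_tile m n) <-> foldable (up_tile m (n + 1)).
Proof.
split=> [/foldable_down|h].
  rewrite /up_tile triangle_rot.
  by flip m (n + 1) (m + 1) (n + 1).
apply: foldable_up; rewrite /down_tile triangle_rot triangle_rot; move: h.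
by flip m (n + 1) (m + 1) (n + 1).
Qed.

Lemma foldable_all m n : foldable (up_tile m n).
Proof.
have g0 : foldable (up_tile 0 0).
  exists id; first exact: refl_comp_id.
  by rewrite image_id /up_tile !add0r; case: vertex_pt => <- <- <-.
have step (P : int -> Prop) : P 0 -> (forall k, P k <-> P (k + 1)) -> forall k, P k.
  move=> P0 PS; elim/int_rect => // k Pk.
    by rewrite -addn1 PoszD; apply: (PS _).1.
  by apply: (PS _).2; rewrite -addn1 PoszD opprD subrK.
apply: (step (fun m => foldable (up_tile m n))) => [|k]; last exact: foldable_right.
by apply: (step (fun n => foldable (up_tile 0 n))) => // k; exact: foldable_above.
Qed.

Lemma folds_to_exists (x : plane) : exists y, folds_to x y.
Proof.
have s2 := sqrt3_sq (R := R); have s0 := sqrt3_gt0 (R := R).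
suff [T [tT Tx [f cf fT]]] : exists T, [/\ tile T, T x & foldable T].
  by exists (f x), T, f.
pose b := 2 * x.2 / s; pose a := x.1 - b / 2.
have [m /andP[]] : exists m : int, m%:~R <= a < (m + 1)%:~R.
  by exists (Num.floor a); exact: floor_itv.
have [n /andP[]] : exists n : int, n%:~R <= b < (n + 1)%:~R.
  by exists (Num.floor b); exact: floor_itv.
rewrite !intrD => n1 n2 m1 m2.
have x2 : x.2 = b * s / 2 by rewrite /b; field; rewrite lt0r_neq0.
have x1 : x.1 = a + b / 2 by rewrite /a; ring.
have [le1|gt1] := lerP (a - m%:~R + (b - n%:~R)) 1.
- exists (up_tile m n); split; last exact: foldable_all.
    exists (pt m n), (pt (m + 1) n), (pt m (n + 1)).
    by split=> //; apply: tile_edge_pt; ring.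
  exists (1 - (a - m%:~R) - (b - n%:~R)), (a - m%:~R), (b - n%:~R); 
    split; [lra|lra|lra|lra|].
  by apply: planeP; rewrite !ptE /= /GRing.scale /= ?x1 ?x2 !intrD; field.
- exists (down_tile m n); split; last exact: foldable_down (foldable_all _ _).
    exists (pt (m + 1) (n + 1)), (pt (m + 1) n), (pt m (n + 1)).
    by split=> //; apply: tile_edge_pt; ring.
  exists ((a - m%:~R) + (b - n%:~R) - 1), (1 - (b - n%:~R)), (1 - (a - m%:~R)); 
    split; [lra|lra|lra|lra|].
  by apply: planeP; rewrite !ptE /= /GRing.scale /= ?x1 ?x2 !intrD; field.
Qed.

Lemma foldP (x y : plane) : fold x = y <-> folds_to x y.
Proof.
have h : folds_to x (fold x) by exact: (
    @xgetPex _ _ [set z | folds_to x z] (folds_to_exists x)).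
by split=> [<- //|h']; exact: folds_to_unique h'.
Qed.

End Fold.

(* Main.v *)
Require Import Defs.
From mathcomp Require Import all_boot all_order all_algebra.
From mathcomp Require Import all_classical all_reals all_analysis.
From mathcomp Require Import ring lra zify.

Import Order.TTheory GRing.Theory Num.Theory.
Local Open Scope classical_set_scope.
Local Open Scope ring_scope.

(* Unfolding the path into a ray, H(a) becomes the family of the copies of the
   tiles shrunk by a about their centroids.  In lattice coordinates the ray has
   direction (A, B) with A, B > 0 and, up to symmetry, slope 1 / x with
   x = A / B >= 1 / 2.  For a = 1 / 4 it meets the hypotenuse of the shrunken tile
   at (m, n) as soon as (4 m + 1) / (4 n + 2) <= x <= (4 m + 2) / (4 n + 1), and
   these intervals cover [1 / 2, +oo).  For a < 1 / 4 the ray of direction (2, 1)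
   misses all the shrunken tiles. *)

(** * Directions in lattice coordinates *)

Section Trigonometry.
Context {R : realType}.
Local Notation s := (Num.sqrt (3 : R)).

Lemma cos_pi3 : cos (pi / 3 : R) = 1 / 2.
Proof.
have p0 := pi_gt0 R.
have c0 : 0 < cos (pi / 3 : R) by apply: cos_gt0_pihalf; lra.
have : cos (pi / 3 + pi / 3 : R) = - cos (pi / 3).
  by rewrite (_ : pi / 3 + pi / 3 = - (pi / 3) + pi) ?cosDpi ?cosN//; field.
have := cos2Dsin2 (pi / 3 : R); rewrite cosD; move: c0.
set c := cos _; set d := sin _ => c0 h1 h2.
have : (2 * c - 1) * (c + 1) = 0 by nra.
by move/eqP; rewrite mulf_eq0 => /orP[] /eqP h; lra.
Qed.

Lemma sin_pi3 : sin (pi / 3 : R) = s / 2.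
Proof.
have p0 := pi_gt0 R; have s2 := sqrt3_sq (R := R); have s0 := sqrt3_gt0 (R := R).
have d0 : 0 < sin (pi / 3 : R) by apply: sin_gt0_pi; lra.
have := cos2Dsin2 (pi / 3 : R); rewrite cos_pi3; move: d0.
set d := sin _ => d0 h.
have : (d - s / 2) * (d + s / 2) = 0 by nra.
by move/eqP; rewrite mulf_eq0 => /orP[] /eqP ?; lra.
Qed.

(** Up to positive factors these are the lattice coordinates of the direction:
    [(cos phi, sin phi) = a *: v1 + b *: v2] with [s * a = s * cos phi - sin phi] and
    [s * b = 2 * sin phi]. *)
Lemma direction_cone (phi : R) : 0 < phi < pi / 3 ->
  0 < sin phi /\ 0 < s * cos phi - sin phi.
Proof.
have p0 := pi_gt0 R => /andP[f0 f1]; split; first by apply: sin_gt0_pi; lra.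
have : 0 < sin (pi / 3 - phi) by apply: sin_gt0_pi; lra.
by rewrite sinB cos_pi3 sin_pi3; lra.
Qed.

(* The direction of [2 *: v1 + v2], whose path is the extremal one. *)
Lemma extremal_direction : exists phi : R,
  0 < phi < pi / 3 /\ sin phi = s / 5 * cos phi.
Proof.
have p0 := pi_gt0 R; have s2 := sqrt3_sq (R := R); have s0 := sqrt3_gt0 (R := R).
have f2 := atan_ltpi2 (s / 5); have f3 := atan_gtNpi2 (s / 5).
have t := atanK (s / 5); exists (atan (s / 5)).
move: f2 f3 t; set phi := atan _ => f2 f3 t.
have c0 : 0 < cos phi by apply: cos_gt0_pihalf; lra.
have e : sin phi = s / 5 * cos phi by rewrite -t /tan divfK// lt0r_neq0.
have s_gt0 : 0 < sin phi by rewrite e; apply: mulr_gt0 => //; lra.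
split=> //; apply/andP; split.
  rewrite ltNge; apply/negP => f0.
  have : 0 <= sin (- phi) by apply: sin_ge0_pi; lra.
  by rewrite sinN; lra.
rewrite ltNge; apply/negP => f0.
have : 0 <= sin (phi - pi / 3) by apply: sin_ge0_pi; lra.
by rewrite sinB cos_pi3 sin_pi3 e; nra.
Qed.

End Trigonometry.

(** The two arguments of the Eisenstein norm agree mod 3 and are not divisible by 3, so the norm is
    a positive multiple of 3. *)
Lemma eisenstein_norm_ge3 (x y u v : int) :
  (exists k l e : int, [/\ u = e + 3 * k, v = e + 3 * l & e = 1 \/ e = -1]) ->
  3 <= (3 * x + u) ^+ 2 + (3 * x + u) * (3 * y + v) + (3 * y + v) ^+ 2.
Proof.
case=> k [l [e [-> -> he]]].
pose V := 3 * (y + l) + e; pose d := x + k - y - l.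
have -> : 3 * x + (e + 3 * k) = V + 3 * d by rewrite /V /d; ring.
have -> : 3 * y + (e + 3 * l) = V by rewrite /V; ring.
have V0 : V != 0 by rewrite /V; case: he => ->; lia.
move: V d V0 => V d V0.
have [d0|d0] := eqVneq d 0.
  by have : 0 < V ^+ 2; [rewrite lt0r sqrf_eq0 V0 sqr_ge0|rewrite d0; lia].
have d2 : 0 < d ^+ 2 by rewrite lt0r sqrf_eq0 d0 sqr_ge0.
have h : 0 <= (2 * V + 3 * d) ^+ 2 by exact: sqr_ge0.
have e4 : 4 * ((V + 3 * d) ^+ 2 + (V + 3 * d) * V + V ^+ 2) =
  3 * ((2 * V + 3 * d) ^+ 2 + 3 * d ^+ 2) by ring.
(* [e4] alone bounds the norm below by 9/4; divisibility by 3 raises this to 3. *)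
have [k0 e3] : exists k0 : int, (V + 3 * d) ^+ 2 + (V + 3 * d) * V + V ^+ 2 = 3 * k0.
  by exists (V ^+ 2 + 3 * d * V + 3 * d ^+ 2); ring.
by move: e4 h d2; rewrite e3; move: (_ ^+ 2) (d ^+ 2) => X Y; lia.
Qed.

(** * Centroids of tiles and shrunken tiles under folding *)

Section Tiles.
Context {R : realType}.
Local Notation plane := (R * R)%type.
Local Notation s := (Num.sqrt (3 : R)).

Lemma tile_edge_steps (a b c d : int) :
  tile_edge (pt a b : plane) (pt c d) ->
  (a - c) ^+ 2 + (a - c) * (b - d) + (b - d) ^+ 2 = 1.
Proof.
case=> _ _ /edist_eq1; rewrite pt_sqdist => /eqP.
by rewrite -[1 in X in X -> _](mulr1z (1 : R)) eqr_int => /eqP.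
Qed.

Lemma tile_vertices (p q r : plane) :
  tile_edge p q -> tile_edge q r -> tile_edge r p ->
  exists a b u v u' v' : int,
    [/\ p = pt a b, q = pt (a + u) (b + v), r = pt (a + u') (b + v')
      & [/\ u ^+ 2 + u * v + v ^+ 2 = 1, u' ^+ 2 + u' * v' + v' ^+ 2 = 1
      & (u - u') ^+ 2 + (u - u') * (v - v') + (v - v') ^+ 2 = 1]].
Proof.
move=> pq qr rp.
have [[a [b ep]] [c [d eq]] _] := pq; have [_ [i [j er]] _] := qr.
rewrite -!/(pt _ _) in ep eq er.
move: pq qr rp; rewrite ep eq er.
move=> /tile_edge_steps h1 /tile_edge_steps h2 /tile_edge_steps h3.
exists a, b, (c - a), (d - b), (i - a), (j - b).
rewrite !(addrC _ (_ - _)) !subrK; split=> //; split.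
- by rewrite -h1; ring.
- by rewrite -h3; ring.
- by rewrite -h2; ring.
Qed.

Lemma refl_comp_affine (f : plane -> plane) : refl_comp f ->
  forall (A B C : plane) (a b c : R), a + b + c = 1 ->
  f (a *: A + b *: B + c *: C) = a *: f A + b *: f B + c *: f C.
Proof.
elim=> [//|g p q _ IH _] A B C a b c h /=.
by rewrite refl_affine// IH.
Qed.

Lemma refl_comp_homothety (f : plane -> plane) (c x : plane) (a : R) :
  refl_comp f -> f (homothety c a x) = homothety (f c) a (f x).
Proof.
(* The zero term gives the three-point shape of [refl_comp_affine]. *)
have E (d y : plane) : homothety d a y = (1 - a) *: d + a *: y + 0 *: y.
  by apply: planeP; rewrite /homothety /= /GRing.scale /=; ring.
by move=> cf; rewrite !E refl_comp_affine//; ring.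
Qed.

Lemma refl_comp_inj (f : plane -> plane) : refl_comp f -> injective f.
Proof.
elim=> [//|g p q _ IH [_ _ e]] x y /= /IH.
by move/(congr1 (refl p q)); rewrite !refl_invol.
Qed.

Definition centroid (p q r : plane) : plane :=
  (1 / 3) *: p + (1 / 3) *: q + (1 / 3) *: r.

Lemma centroid_triangle (p q r : plane) : triangle p q r (centroid p q r).
Proof. by exists (1 / 3), (1 / 3), (1 / 3); split=> //; lra. Qed.

Lemma centroid_sqdist (p q r : plane) (i j : int) :
  tile_edge p q -> tile_edge q r -> tile_edge r p ->
  1 / 3 <= Defs.edist (centroid p q r) (pt i j) ^+ 2.
Proof.
move=> pq qr rp; have s2 := sqrt3_sq (R := R).
have [a [b [u [v [u' [v' [-> -> -> [h1 h2 h3]]]]]]]] := tile_vertices _ _ _ pq qr rp.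
rewrite edistE sqr_sqrtr ?addr_ge0 ?sqr_ge0//.
(* [(U, V)] are the lattice coordinates of three times the vector from [pt i j] to the centroid.
   Both are 1 or both are -1 mod 3, depending on the orientation of the tile. *)
pose U := 3 * (a - i) + (u + u'); pose V := 3 * (b - j) + (v + v').
have N : 3 <= U ^+ 2 + U * V + V ^+ 2.
{ apply: eisenstein_norm_ge3.
  move: h3; case/unit_steps: h1 => [[[->|->] ->]|[[-> [->|->]]|[[-> ->]|[-> ->]]]];
  case/unit_steps: h2 => [[[->|->] ->]|[[-> [->|->]]|[[-> ->]|[-> ->]]]] h3;
  (by exfalso; move/eqP: h3) || idtac.
  all: first [ by exists 0, 0, 1; split; [ring|ring|left]
             | by exists 0, 0, (-1); split; [ring|ring|right]
             | by exists 0, (-1), 1; split; [ring|ring|left]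
             | by exists (-1), 0, 1; split; [ring|ring|left]
             | by exists 0, 1, (-1); split; [ring|ring|right]
             | by exists 1, 0, (-1); split; [ring|ring|right] ]. }
have : (3 : R) <= (U ^+ 2 + U * V + V ^+ 2)%:~R by rewrite (ler_int _ 3).
rewrite /U /V /centroid !ptE /= /GRing.scale /= !(intrD, intrM, mulrNz, rmorphXn) /=.
set A := a%:~R; set B := b%:~R; set I := i%:~R; set J := j%:~R.
set X := u%:~R; set Y := v%:~R; set X' := u'%:~R; set Y' := v'%:~R => h.
set B1 := 1 / 3 * (B * s / 2) + _ + _ - _.
have -> : B1 ^+ 2 = ((B - J) + (Y + Y') / 3) ^+ 2 * (s * s) / 4 by rewrite /B1; field.
by rewrite s2; lra.
Qed.

Lemma Q_center (y : plane) : Q y ->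
  (forall i j : int, 1 / 3 <= Defs.edist y (pt i j) ^+ 2) -> y = incenter v0 v1 v2.
Proof.
have s2 := sqrt3_sq (R := R); have s0 := sqrt3_gt0 (R := R).
move=> [a [b [c [a0 b0 c0 abc ->]]]] h; rewrite incenterE.
have := h 0 1; have := h 1 0; have := h 0 0; move=> {h}.
have -> : a = 1 - b - c by lra.
rewrite !edistE !sqr_sqrtr ?addr_ge0 ?sqr_ge0// !ptE /= /GRing.scale /= => h0 h1 h2.
have q0 : 1 / 3 <= b ^+ 2 + b * c + c ^+ 2 by nra.
have q1 : 1 / 3 <= (b - 1) ^+ 2 + (b - 1) * c + c ^+ 2 by nra.
have q2 : 1 / 3 <= b ^+ 2 + b * (c - 1) + (c - 1) ^+ 2 by nra.
have a0' : 0 <= 1 - b - c by lra.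
(* The squared distances of y to the vertices, weighted by its barycentric
   coordinates, sum to [a b + b c + c a <= 1 / 3]. *)
have le0 : (b - 1 / 3) ^+ 2 + (b - 1 / 3) * (c - 1 / 3) + (c - 1 / 3) ^+ 2 <= 0.
  rewrite -subr_ge0 in q0; rewrite -subr_ge0 in q1; rewrite -subr_ge0 in q2.
  have := addr_ge0 (addr_ge0 (mulr_ge0 a0' q0) (mulr_ge0 b0 q1)) (mulr_ge0 c0 q2).
  by lra.
have c2 := sqr_ge0 (c - 1 / 3); have b2 := sqr_ge0 (b - 1 / 3).
(* Completing the square in either variable shows the form of [le0] to be positive definite. *)
have m1 := sqr_ge0 (b - 1 / 3 + (c - 1 / 3) / 2).
have m2 := sqr_ge0 (c - 1 / 3 + (b - 1 / 3) / 2).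
have /eqP : (b - 1 / 3) ^+ 2 = 0 by lra.
have /eqP : (c - 1 / 3) ^+ 2 = 0 by lra.
rewrite !sqrf_eq0 => /eqP ec /eqP eb.
have -> : b = 1 / 3 by lra.
have -> : c = 1 / 3 by lra.
by apply: planeP; rewrite /= /GRing.scale /=; field.
Qed.

(* Folding maps lattice points onto lattice points, and the centroid is the only
   point of a tile at distance at least [1 / sqrt 3] from all of them. *)
Lemma fold_centroid (p q r : plane) (f : plane -> plane) :
  tile_edge p q -> tile_edge q r -> tile_edge r p ->
  refl_comp f -> f @` triangle p q r = Q ->
  f (centroid p q r) = incenter v0 v1 v2.
Proof.
move=> pq qr rp cf fT; apply: Q_center.
  by rewrite -fT; exists (centroid p q r) => //; exact: centroid_triangle.
move=> i j; have [|x [a [b [c [-> _]]]] <-] := refl_comp_colored (k := i - j) cf (x := pt i j).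
  by exists i, j, 0; rewrite mulr0 addr0.
by rewrite (refl_comp_isom cf); exact: centroid_sqdist.
Qed.

(** [f] is injective and affine and takes the tile to [Q] and its centroid to the incenter, so it
    carries the homothety of one to that of the other. *)
Lemma fold_in_H (p q r z : plane) (f : plane -> plane) (a : R) :
  tile_edge p q -> tile_edge q r -> tile_edge r p ->
  refl_comp f -> f @` triangle p q r = Q ->
  H a (f z) <->
  exists2 w, triangle p q r w & z = homothety (centroid p q r) a w.
Proof.
move=> pq qr rp cf fT; rewrite /H -(fold_centroid _ _ _ _ pq qr rp cf fT); split.
  case=> y; rewrite -{1}fT => -[w Tw <-].
  rewrite -refl_comp_homothety// => /(refl_comp_inj _ cf) <-.
  by exists w.
by case=> w Tw ->; exists (f w); rewrite ?refl_comp_homothety// -fT; exists w.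
Qed.

End Tiles.

(** * Ratio 1/4 meets every nontrivial path *)

Section UpperBound.
Context {R : realType}.
Local Notation plane := (R * R)%type.
Local Notation s := (Num.sqrt (3 : R)).

(* The ray of slope [1 / x] in lattice coordinates meets the hypotenuse of the
   small triangle of [up_tile m n]. *)
Lemma slope_hit (x : R) : 1 / 2 <= x -> exists m n : nat,
  4 * m%:R + 1 <= x * (4 * n%:R + 2) /\ x * (4 * n%:R + 1) <= 4 * m%:R + 2.
Proof.
move=> x1; have [x2|x2] := lerP x 2; first by exists 0%N, 0%N; lra.
(* For [n = 0] the intervals [[(4m+1)/2, 4m+2]], [m >= 1], overlap and cover [[5/2, +oo)]. *)
have [x3|x3] := lerP (5 / 2) x.
  have [|] := andP (@truncn_itv _ ((2 * x - 1) / 4) _); first by lra.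
  set m := Num.trunc _; rewrite -natr1 => h1 h2; exists m, 0%N.
  suff : 1 <= m%:R :> R by lra.
  rewrite ler1n lt0n; apply/eqP => m0; rewrite m0 in h2; lra.
(* On [(2, 5/2)] take [m = 2n + 1]: the intervals [[2 + 1/(4n+2), 2 + 4/(4n+1)]], [n >= 1], overlap
   and accumulate at 2. The choice is the [n] with [4n - 2 <= 1/(x-2) < 4n + 2]. *)
have d0 : 0 < x - 2 by lra.
have hd : (x - 2)^-1 * (x - 2) = 1 by rewrite mulVf// lt0r_neq0.
have hi : 2 <= (x - 2)^-1 by rewrite -(@ler_pM2r _ (x - 2))// hd; lra.
have [|] := andP (@truncn_itv _ (((x - 2)^-1 - 2) / 4) _); first by lra.
set k := Num.trunc _; rewrite -natr1 => h1 h2; exists (2 * k.+1 + 1)%N, k.+1.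
rewrite natrD natrM -natr1.
have h3 : (4 * k%:R + 2) * (x - 2) <= 1.
  by rewrite -[leRHS]hd ler_pM2r//; lra.
have h4 : 1 <= (4 * k%:R + 6) * (x - 2).
  by rewrite -[leLHS]hd ler_pM2r//; lra.
by split; lra.
Qed.

(** The conditions are homogeneous in [(A, B)] and invariant under exchanging [(A, m)] with
    [(B, n)], which reduces them to [slope_hit]. *)
Lemma direction_hit (A B : R) : 0 < A -> 0 < B -> exists m n : nat,
  B * (4 * m%:R + 1) <= A * (4 * n%:R + 2) /\
  A * (4 * n%:R + 1) <= B * (4 * m%:R + 2).
Proof.
have wlog_hit (A' B' : R) : 0 < A' -> 0 < B' -> B' / 2 <= A' -> exists m n : nat,
    B' * (4 * m%:R + 1) <= A' * (4 * n%:R + 2) /\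
    A' * (4 * n%:R + 1) <= B' * (4 * m%:R + 2).
  move=> A0 B0 h; have [|m [n [h1 h2]]] := slope_hit (A' / B').
    by rewrite ler_pdivlMr//; lra.
  exists m, n; split.
  - by rewrite mulrC -ler_pdivlMr// mulrAC.
  - by rewrite [leRHS]mulrC -ler_pdivrMr// mulrAC.
move=> A0 B0; have [h|h] := lerP (B / 2) A; first exact: wlog_hit.
by have [|m [n [h1 h2]]] := wlog_hit B A B0 A0; [lra|exists n, m].
Qed.

Lemma quarter_hits (phi : R) : 0 < phi < pi / 3 ->
  (H (1 / 4) `&` billiard_path phi) !=set0.
Proof.
have s2 := sqrt3_sq (R := R); have s0 := sqrt3_gt0 (R := R).
move=> /direction_cone[B0 A0].
have [|m [n [h1 h2]]] := direction_hit (s * cos phi - sin phi) (2 * sin phi) A0.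
  by lra.
pose D := s * cos phi + sin phi.
have D0 : 0 < D by rewrite /D; lra.
(* The time at which the lattice coordinates sum to [m + n + 3/4], the line of the hypotenuse of the
   shrunken tile, whose right-angle corner in these coordinates is [(m + 1/4, n + 1/4)]. *)
pose t := (m%:R + n%:R + 3 / 4) * s / D.
have t0 : 0 <= t by rewrite /t divr_ge0 ?mulr_ge0 ?addr_ge0 ?ler0n//; lra.
pose z : plane := t *: (cos phi, sin phi).
have T01 : tile_edge (pt m n : plane) (pt (m%:Z + 1) n) by apply: tile_edge_pt; ring.
have T12 : tile_edge (pt (m%:Z + 1) n : plane) (pt m (n%:Z + 1)).
  by apply: tile_edge_pt; ring.
have T20 : tile_edge (pt m (n%:Z + 1) : plane) (pt m n) by apply: tile_edge_pt; ring.
have [f cf fT] := @foldable_all R m n.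
(* lattice coordinates of [z] *)
pose a := (m%:R + n%:R + 3 / 4) * (s * cos phi - sin phi) / D.
pose b := (m%:R + n%:R + 3 / 4) * (2 * sin phi) / D.
have Dn : D != 0 by rewrite lt0r_neq0.
have ab : a + b = m%:R + n%:R + 3 / 4 by rewrite /a /b /D; field.
have a1 : m%:R + 1 / 4 <= a by rewrite /a ler_pdivlMr// /D; lra.
have b1 : n%:R + 1 / 4 <= b by rewrite /b ler_pdivlMr// /D; lra.
have ez : z = (a + b / 2, b * s / 2).
  apply: planeP; rewrite /z /= /GRing.scale /= /t /a /b; last by field.
  have -> : s * cos phi - sin phi = D - 2 * sin phi by rewrite /D; ring.
  transitivity ((m%:R + n%:R + 3 / 4) / D * (s * cos phi)); first by field.
  have -> : s * cos phi = D - sin phi by rewrite /D; ring.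
  by field.
(* The preimage of [z] under the homothety, on the side of the tile opposite [pt m n]. *)
pose w : plane := (m%:R + (4 * (a - m%:R) - 1) + (n%:R + (4 * (b - n%:R) - 1)) / 2,
   (n%:R + (4 * (b - n%:R) - 1)) * s / 2).
have Tw : up_tile m n w.
  exists 0, (4 * (a - m%:R) - 1), (4 * (b - n%:R) - 1).
  split; [lra|lra|lra|lra|].
  have eb : b = m%:R + n%:R + 3 / 4 - a by lra.
  by apply: planeP; rewrite !ptE /w /= /GRing.scale /= !intrD eb -!pmulrn; field.
have ezw : z = homothety (centroid (pt m n) (pt (m%:Z + 1) n) (pt m (n%:Z + 1)))
                 (1 / 4) w.
  rewrite ez; apply: planeP;
    rewrite /homothety /centroid !ptE /w /= /GRing.scale /= !intrD -!pmulrn; by field.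
have Hz : H (1 / 4) (f z) by apply/(fold_in_H _ _ _ _ _ _ T01 T12 T20 cf fT); exists w.
exists (f z); split=> //; exists z; first by exists t.
apply/foldP; exists (up_tile m n), f; split=> //.
  by exists (pt m n), (pt (m%:Z + 1) n), (pt m (n%:Z + 1)).
exists (m%:R + n%:R + 1 - a - b), (a - m%:R), (b - n%:R).
split; [lra|lra|lra|lra|].
by rewrite -/z ez; apply: planeP; rewrite !ptE /= /GRing.scale /= !intrD -!pmulrn; field.
Qed.

End UpperBound.

(** * Smaller ratios miss the extremal path *)

Section LowerBound.
Context {R : realType}.
Local Notation plane := (R * R)%type.
Local Notation s := (Num.sqrt (3 : R)).

Lemma int_gap (k m : int) : ~ (k%:~R < m%:~R :> R /\ m%:~R < k%:~R + 1 :> R).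
Proof. by case; rewrite ltr_int -(intrD _ k 1) ltr_int; lia. Qed.

(* The form [x.1 - 5 x.2 / sqrt 3], which is [i - 2 j] at [pt i j], vanishes on
   the extremal direction.  Its values at the vertices of a tile are
   [g, g + 1, g - 2] or [g, g - 1, g + 2] for some integer [g], hence on the
   concentric tile of ratio [a < 1 / 4] they lie strictly between two
   consecutive integers. *)
Lemma extremal_miss (p q r w : plane) (a : R) : 0 < a < 1 / 4 ->
  tile_edge p q -> tile_edge q r -> tile_edge r p -> triangle p q r w ->
  s * (homothety (centroid p q r) a w).1 != 5 * (homothety (centroid p q r) a w).2.
Proof.
have s0 := sqrt3_gt0 (R := R).
move=> /andP[a0 a1] pq qr rp [w0 [w1 [w2 [h0 h1 h2 hw ->]]]].
have [i [j [u [v [u' [v' [-> -> -> [k1 k2 k3]]]]]]]] := tile_vertices _ _ _ pq qr rp.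
apply/eqP => /eqP; rewrite -subr_eq0 /homothety /centroid !ptE /= /GRing.scale /=.
rewrite !intrD.
have -> : w0 = 1 - w1 - w2 by lra.
set I := i%:~R; set J := j%:~R; set U := u%:~R; set V := v%:~R.
set U' := u'%:~R; set V' := v'%:~R.
(* Naming these products makes the remaining inequalities linear. *)
pose y1 := a * w1; pose y2 := a * w2.
set E := (X in X == 0).
have -> : E = s * (I - 2 * J + (1 - a) * ((U - 2 * V) + (U' - 2 * V')) / 3
                   + y1 * (U - 2 * V) + y2 * (U' - 2 * V')).
  by rewrite /E /y1 /y2; field.
rewrite mulf_eq0 gt_eqF//= => /eqP.
have -> : I - 2 * J = (i - 2 * j)%:~R by rewrite intrB intrM.
move: (i - 2 * j) => g {E}.
have y1_ge0 : 0 <= y1 by rewrite mulr_ge0// ltW.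
have y2_ge0 : 0 <= y2 by rewrite mulr_ge0// ltW.
have y12 : y1 + y2 <= a by rewrite /y1 /y2 -mulrDr ler_piMr ?(ltW a0)//; lra.
move: y1 y2 y1_ge0 y2_ge0 y12 => y1 y2 y1_ge0 y2_ge0 y12.
rewrite /U /V /U' /V'; move: k3.
case/unit_steps: k1 => [[[->|->] ->]|[[-> [->|->]]|[[-> ->]|[-> ->]]]];
case/unit_steps: k2 => [[[->|->] ->]|[[-> [->|->]]|[[-> ->]|[-> ->]]]] k3;
(by exfalso; move/eqP: k3) || idtac; rewrite ?mulrNz ?mulr0z ?mulr1z => hg.
(* The vanishing of the form puts [g], its value at [p], strictly between two consecutive integers;
   which ones depends on the orientation of the tile and on the vertex taken as [p]. *)
all: first [ by apply: (int_gap 0 g); split; lra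
           | by apply: (int_gap 1 g); split; lra
           | by apply: (int_gap 2 g); split; lra
           | by apply: (int_gap (-1) g); split; lra
           | by apply: (int_gap (-2) g); split; lra
           | by apply: (int_gap (-3) g); split; lra ].
Qed.

Lemma quarter_le (a : R) : 0 < a ->
  (forall phi : R, 0 < phi < pi / 3 -> (H a `&` billiard_path phi) !=set0) ->
  1 / 4 <= a.
Proof.
have s2 := sqrt3_sq (R := R).
move=> a0 hit; rewrite leNgt; apply/negP => a1.
have [phi [hphi e]] := extremal_direction (R := R).
have [y [Hy [z [t _ ez]] /foldP]] := hit phi hphi.
move=> [T [f [[p [q [r [pq qr rp ->]]]] Tz cf fT ey]]].
move: Hy; rewrite ey => /(fold_in_H _ _ _ _ _ _ pq qr rp cf fT)[w Tw zw].
have := extremal_miss p q r w a; rewrite a0 a1 -zw ez => /(_ isT pq qr rp Tw).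
by apply/negP; rewrite negbK /= /GRing.scale /= e; apply/eqP; field.
Qed.

End LowerBound.

Theorem theorem29 (R : realType) :
  inf [set a : R | 0 < a < 1 /\
         forall phi : R, 0 < phi < pi / 3 ->
           (H a `&` billiard_path phi) !=set0] = 1 / 4.
Proof.
set S := [set a | _].
have S4 : S (1 / 4) by split; [lra|exact: quarter_hits].
have lbS : lbound S (1 / 4) by move=> a [/andP[a0 _]]; exact: quarter_le.
apply/le_anti/andP; split.
- by apply: ge_inf => //; exists (1 / 4).
- by apply: lb_le_inf => //; exists (1 / 4).
Qed.
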